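(* Let $K$ be a field, let $c \ge 1$ be an integer and let $\mathbf{P} = (\mathbf{X}^{\mathrm{OI},1})^{\otimes c}$. If $\mathbf{M}$ is a finitely generated graded $\mathrm{OI}$-module over $\mathbf{P}$, then, for any fixed integer $j$, there is a polynomial $p(t) \in \mathbb{Q}[t]$ such that $\dim_K [\mathbf{M}_n]_j = p(n)$ for all sufficiently large $n$.
   Context: $\mathrm{OI}$ is the category with objects $[n] = \{1,\dots,n\}$, $n \ge 0$ ($[0]=\emptyset$), and morphisms the strictly increasing maps $\varepsilon\colon [m]\to[n]$. The $\mathrm{OI}$-algebra $\mathbf{P} = (\mathbf{X}^{\mathrm{OI},1})^{\otimes c}$ over $K$ is the functor from $\mathrm{OI}$ to commutative $K$-algebras with $\mathbf{P}_n = K[x_{i,j} : 1\le i\le c,\ 1\le j\le n]$ (so $\mathbf{P}_0=K$) and, for $\varepsilon\colon[m]\to[n]$, $\varepsilon_*\colon \mathbf{P}_m\to\mathbf{P}_n$ the $K$-algebra homomorphism with $\varepsilon_*(x_{i,j}) = x_{i,\varepsilon(j)}$. Every variable has degree one. An $\mathrm{OI}$-module $\mathbf{M}$ over $\mathbf{P}$ is a functor from $\mathrm{OI}$ to $K$-vector spaces such that each $\mathbf{M}_n = \mathbf{M}([n])$ is a $\mathbf{P}_n$-module and $\mathbf{M}(\varepsilon)(aq) = \varepsilon_*(a)\,\mathbf{M}(\varepsilon)(q)$ for all $\varepsilon\colon[m]\to[n]$, $a\in\mathbf{P}_m$, $q\in\mathbf{M}_m$. It is graded if every $\mathbf{M}_n$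 is a $\mathbb{Z}$-graded $\mathbf{P}_n$-module and every $\mathbf{M}(\varepsilon)$ is homogeneous of degree $0$. It is finitely generated if there is a finite subset of $\coprod_n \mathbf{M}_n$ that is not contained in any proper $\mathrm{OI}$-submodule. $[\mathbf{M}_n]_j$ is the degree $j$ component of $\mathbf{M}_n$. *)

(* Defs.v *)
From HB Require Import structures.
From mathcomp Require Import all_boot all_order all_algebra.
From mathcomp Require Export mpoly.

Set Implicit Arguments.
Unset Strict Implicit.
Unset Printing Implicit Defensive.

Import GRing.Theory.
Local Open Scope ring_scope.

(* The object [n] = {1, ..., n} of OI is represented by 'I_n = {0, ..., n-1}. *)
Record oi_mor (m n : nat) := OIMor {
  oi_fun :> {ffun 'I_m -> 'I_n};
  oi_incr : [forall i : 'I_m, forall j : 'I_m, (i < j)%N ==> (oi_fun i < oi_fun j)%N]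
}.

Lemma oi_morP m n (f : {ffun 'I_m -> 'I_n}) :
  reflect (forall i j : 'I_m, (i < j)%N -> (f i < f j)%N)
          [forall i : 'I_m, forall j : 'I_m, (i < j)%N ==> (f i < f j)%N].
Proof.
by apply: (iffP forallP) => h i; [move=> j; have /forallP/(_ j)/implyP := h i
  | apply/forallP => j; apply/implyP/h].
Qed.

Lemma oi_id_incr n :
  [forall i : 'I_n, forall j : 'I_n,
    (i < j)%N ==> ([ffun k : 'I_n => k] i < [ffun k : 'I_n => k] j)%N].
Proof. by apply/oi_morP => i j; rewrite !ffunE. Qed.

Definition oi_id n : oi_mor n n := OIMor (oi_id_incr n).

Lemma oi_comp_incr l m n (g : oi_mor m n) (f : oi_mor l m) :
  [forall i : 'I_l, forall j : 'I_l,
    (i < j)%N ==> ([ffun k => g (f k)] i < [ffun k => g (f k)] j)%N].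
Proof.
apply/oi_morP => i j ij; rewrite !ffunE.
by apply: (oi_morP _ (oi_incr g)); apply: (oi_morP _ (oi_incr f)).
Qed.

Definition oi_comp l m n (g : oi_mor m n) (f : oi_mor l m) : oi_mor l n :=
  OIMor (oi_comp_incr g f).

Section OIAlgebra.
Variables (K : fieldType) (c : nat).

(* K[x_{i,j} : i <= c, j <= n], the variable x_{i,j} being numbered
   mxvec_index i j in 'I_(c * n). *)
Definition oiP (n : nat) : comNzRingType := {mpoly K[c * n]}.

Definition oi_var n (i : 'I_c) (j : 'I_n) : oiP n := 'X_(mxvec_index i j).

Definition oiP_map m n (eps : oi_mor m n) (p : oiP m) : oiP n :=
  p \mPo [tuple mxvec (\matrix_(i < c, j < m) oi_var i (eps j)) 0 k | k < c * m].

Lemma oiP_map_var m n (eps : oi_mor m n) (i : 'I_c) (j : 'I_m) :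
  oiP_map eps (oi_var i j) = oi_var i (eps j).
Proof.
by rewrite /oiP_map /oi_var comp_mpolyXU -tnth_nth tnth_mktuple mxvecE mxE.
Qed.

(* The K-vector space structure on M_n is restricted from P_n; K-linearity of
   oi_map then follows from oi_map_semilinear, as oiP_map fixes constants. *)
Record oi_module := OIModule {
  oi_obj :> forall n : nat, lmodType (oiP n);
  oi_map : forall m n : nat, oi_mor m n -> {additive oi_obj m -> oi_obj n};
  oi_map_id : forall (n : nat) (q : oi_obj n), oi_map (oi_id n) q = q;
  oi_map_comp : forall (l m n : nat) (g : oi_mor m n) (f : oi_mor l m)
      (q : oi_obj l), oi_map (oi_comp g f) q = oi_map g (oi_map f q);
  oi_map_semilinear : forall (m n : nat) (eps : oi_mor m n) (a : oiP m)
      (q : oi_obj m), oi_map eps (a *: q) = oiP_map eps a *: oi_map eps q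
}.

Definition kscale n (V : lmodType (oiP n)) (k : K) (v : V) : V :=
  (k%:MP : oiP n) *: v.

Record is_grading n (V : lmodType (oiP n)) (W : int -> V -> Prop) : Prop :=
  IsGrading {
  grading0 : forall j, W j 0;
  gradingD : forall j u v, W j u -> W j v -> W j (u + v);
  gradingZ : forall j k v, W j v -> W j (kscale k v);
  grading_span : forall v, exists (s : seq int) (f : int -> V),
    [/\ uniq s, forall j, W j (f j) & v = \sum_(j <- s) f j];
  grading_direct : forall (s : seq int) (f : int -> V),
    uniq s -> (forall j, W j (f j)) -> \sum_(j <- s) f j = 0 ->
    forall j, j \in s -> f j = 0;
  grading_mul : forall (d : nat) (j : int) (a : oiP n) (v : V),
    a \is d.-homog -> W j v -> W (d%:Z + j) (a *: v)
}.

Record graded_oi_module := GradedOIModule {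
  goi_module :> oi_module;
  goi_comp : forall n : nat, int -> goi_module n -> Prop;
  goi_grading : forall n : nat, is_grading (@goi_comp n);
  goi_map_comp : forall (m n : nat) (eps : oi_mor m n) (j : int)
      (q : goi_module m), goi_comp j q -> goi_comp j (oi_map goi_module eps q)
}.

Record is_oi_submodule (M : oi_module) (N : forall n, M n -> Prop) : Prop :=
  IsOISubmodule {
  oi_sub0 : forall n, N n 0;
  oi_subD : forall n (u v : M n), N n u -> N n v -> N n (u + v);
  oi_subZ : forall n (a : oiP n) (v : M n), N n v -> N n (a *: v);
  oi_sub_map : forall m n (eps : oi_mor m n) (v : M m),
    N m v -> N n (oi_map M eps v)
}.

Definition oi_proper (M : oi_module) (N : forall n, M n -> Prop) : Prop :=
  exists n (v : M n), ~ N n v.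

Definition oi_fin_gen (M : oi_module) : Prop :=
  exists s : seq {n : nat & M n},
    forall N : forall n, M n -> Prop, is_oi_submodule N -> oi_proper N ->
      ~ (forall x, x \in s -> N (tag x) (tagged x)).

Definition has_kdim n (V : lmodType (oiP n)) (W : V -> Prop) (d : nat) : Prop :=
  exists b : 'I_d -> V,
    [/\ forall i, W (b i),
        forall a : 'I_d -> K, \sum_(i < d) kscale (a i) (b i) = 0 ->
          forall i, a i = 0
      & forall v, W v -> exists a : 'I_d -> K, v = \sum_(i < d) kscale (a i) (b i)].

End OIAlgebra.

Arguments goi_comp {K c} _ n _ _.

(* Main.v *)
Require Import Defs.
From HB Require Import structures.
From mathcomp Require Import all_boot all_order all_algebra.
From mathcomp Require Import mpoly.
From mathcomp Require Import boolp.
From mathcomp Require Import zify ring.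

Set Implicit Arguments.
Unset Strict Implicit.
Unset Printing Implicit Defensive.

Import GRing.Theory.
Local Open Scope ring_scope.

(** The degree j parts of M form a finitely generated functor V from OI to
K-vector spaces, and for such functors the dimension is eventually a
polynomial, by a Groebner basis argument that ends in counting 0-1 words.

Reduction to vector spaces. Finitely many homogeneous elements generate M, so
that [M_n]_j is spanned over K by the products of a monomial of degree d in
the variables with a translate f_* q of a generator q of degree j - d. Such a
monomial involves at most d columns of variables. If q has width l, these
columns and the image of f together occupy at most l + d positions of [n], so
the product is the image, under some increasing map [m] -> [n], of an element
of the same shape in M_m, for every m with l + d <= m <= n. A common m serves
all generators, and for n >= m the space [M_n]_j is spanned by the images of
finitely many elements g_0, ..., g_(r-1) of [M_m]_j (component_span).

Standard monomials. Encode an increasing map f : [m] -> [n] by the 0-1 word of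
length n whose ones mark the image of f. Order the pairs (k, f), standing for
the vectors f_* g_k, by k and then lexicographically by words. The pairs whose
vector is not a combination of smaller ones index a basis of the span
(has_dim_standard). Composing with the map [n] -> [n+1] that skips one value
inserts a zero at a fixed place in all words at once, which preserves the
order; hence being nonstandard persists under insertion of zeros.

Counting. It remains to count, for a set U of words stable under insertion of
zeros, the words of length n with m ones that avoid U (avoid_count_eventually_poly).
A word with m ones is a sequence of m+1 gap lengths, U corresponds to a
monomial ideal in m+1 variables, and the count is the Hilbert function of the
quotient. The proof is by induction on m, splitting words by their first
letter. Removing more and more leading zeros produces an increasing chain of
sets, stationary by a form of Dickson's lemma
(stationary_insertion_closed); at the stationary stage the count has an
eventually polynomial first difference, and each earlier stage is obtained
from the next by a shift of n and an eventually polynomial summand. *)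

(** * Eventually polynomial functions *)

Definition eventually_poly (h : nat -> nat) : Prop :=
  exists p : {poly rat}, exists N : nat, forall n : nat, (N <= n)%N ->
    (h n)%:R = p.[n%:R].

Lemma eventually_poly_const a N (h : nat -> nat) :
  (forall n, (N <= n)%N -> h n = a) -> eventually_poly h.
Proof. by move=> ha; exists a%:R%:P, N => n /ha ->; rewrite hornerC. Qed.

Lemma eventually_polyD (g h : nat -> nat) :
  eventually_poly g -> eventually_poly h -> eventually_poly (fun n => g n + h n)%N.
Proof.
move=> [p [N hp]] [q [N' hq]]; exists (p + q), (maxn N N') => n.
by rewrite geq_max hornerD natrD => /andP[/hp-> /hq->].
Qed.

Lemma eventually_poly_sum (I : Type) (r : seq I) (h : I -> nat -> nat) :
  (forall i, eventually_poly (h i)) -> eventually_poly (fun n => \sum_(i <- r) h i n)%N.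
Proof.
move=> hh; elim: r => [|i r IH].
  by apply: (@eventually_poly_const 0%N 0%N) => n _; rewrite big_nil.
have [p [N hp]] := eventually_polyD (hh i) IH.
by exists p, N => n /hp <-; rewrite big_cons.
Qed.

Lemma eventually_poly_shift k (g h : nat -> nat) :
  (forall n, h (n + k)%N = g n) -> eventually_poly g -> eventually_poly h.
Proof.
move=> hg [p [N hp]]; exists (p \Po ('X - k%:R%:P)), (N + k)%N => n hn.
have le_kn : (k <= n)%N by lia.
rewrite horner_comp hornerXsubC -natrB // -hp; last by lia.
by rewrite -hg subnK.
Qed.

(** By the binomial theorem the difference of t^(d+1) is (d+1) t^d plus lower
powers of t, whose antidifferences are available by induction. *)
Lemma antidifference_Xn d : exists q : {poly rat}, forall n : nat,
  q.[n.+1%:R] - q.[n%:R] = n%:R ^+ d.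
Proof.
elim/ltn_ind: d => d IH.
have [Q hQ] := choice (fun i : 'I_d => IH i (ltn_ord i)).
exists (d.+1%:R^-1 *: ('X^(d.+1) - \sum_(i < d) Q i *+ 'C(d.+1, i))) => n.
rewrite !hornerE !horner_sum -mulrBr.
have dE : \sum_(i < d) (Q i *+ 'C(d.+1, i)).[n.+1%:R] =
    \sum_(i < d) (Q i *+ 'C(d.+1, i)).[n%:R]
      + \sum_(i < d) n%:R ^+ i *+ 'C(d.+1, i).
  rewrite -big_split /=; apply: eq_bigr => i _.
  by rewrite !hornerMn -mulrnDl -hQ addrCA subrr addr0.
(* Binomial expansion, with the terms of degree d+1 and d split off. *)
have nE : n.+1%:R ^+ d.+1 = n%:R ^+ d.+1 + (d.+1%:R * n%:R ^+ d
      + \sum_(i < d) n%:R ^+ i *+ 'C(d.+1, i)) :> rat.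
  rewrite -[n.+1]add1n natrD exprDn 2!big_ord_recr /=.
  rewrite binn subnn subSnn expr0 mulr1n mul1r binSn expr1n mul1r.
  rewrite [RHS]addrC [X in _ = X + _]addrC mulr_natl; congr (_ + _ + _).
  by apply: eq_bigr => i _; rewrite expr1n mul1r.
rewrite dE nE; apply: (mulfI (_ : d.+1%:R != 0 :> rat)).
  by rewrite Num.Theory.pnatr_eq0.
rewrite mulVKf ?Num.Theory.pnatr_eq0 //; ring.
Qed.

Lemma antidifference (p : {poly rat}) : exists q : {poly rat}, forall n : nat,
  q.[n.+1%:R] - q.[n%:R] = p.[n%:R].
Proof.
have [Q hQ] := choice antidifference_Xn.
exists (\sum_(i < size p) p`_i *: Q i) => n.
rewrite !horner_sum -sumrB horner_coef; apply: eq_bigr => i _.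
by rewrite !hornerZ -mulrBr hQ.
Qed.

Lemma eventually_poly_antidifference (g h : nat -> nat) :
  eventually_poly g -> (forall n, h n.+1 = (g n + h n)%N) -> eventually_poly h.
Proof.
move=> [p [N hp]] hS; have [q hq] := antidifference p.
exists (q + ((h N)%:R - q.[N%:R])%:P), N => n /subnK <-.
elim: (n - N)%N => [|k IH]; first by rewrite add0n hornerD hornerC addrC subrK.
by rewrite addSn hS natrD IH hp ?leq_addl // -hq !hornerD !hornerC addrA subrK.
Qed.

(** * Words avoiding a set stable under insertion of zeros *)

(** In terms of gap lengths between ones, inserting zeros increases the gaps, so
these are the monomial ideals in as many variables as there are gaps. *)
Definition insertion_closed (U : bitseq -> Prop) : Prop :=
  forall u v, U (u ++ v) -> U (u ++ false :: v).

Lemma chain_mono (X : Type) (U : nat -> X -> Prop) x :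
  (forall i, U i x -> U i.+1 x) -> forall i j, (i <= j)%N -> U i x -> U j x.
Proof.
move=> Umono i j /subnK <-; elim: (j - i)%N => // k IH Ux.
by rewrite addSn; apply/Umono/IH.
Qed.

(** The ascending chain condition for the predicates in the class C, seen on D only. *)
Definition stationary_chains (X : Type) (D : X -> Prop)
    (C : (X -> Prop) -> Prop) : Prop :=
  forall U : nat -> X -> Prop, (forall i, C (U i)) ->
    (forall i x, U i x -> U i.+1 x) ->
    exists T, forall i x, D x -> U i x -> U T x.

(** A family U i t increasing in both indices has a stationary diagonal, say from
T0 on, and this controls U i t for all i and all t >= T0. The finitely many
rows t < T0 are stationary separately. *)
Lemma stationary_double (X : Type) (D : X -> Prop) (C : (X -> Prop) -> Prop)
    (U : nat -> nat -> X -> Prop) :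
  stationary_chains D C -> (forall i t, C (U i t)) ->
  (forall i t x, U i t x -> U i.+1 t x) ->
  (forall i t x, U i t x -> U i t.+1 x) ->
  exists T, forall i t x, D x -> U i t x -> U T t x.
Proof.
move=> accC CU Ui Ut.
have leUi t x i j : (i <= j)%N -> U i t x -> U j t x.
  by apply: (@chain_mono X (U ^~ t)) => k; exact: Ui.
have leUt i x s t : (s <= t)%N -> U i s x -> U i t x.
  by apply: (@chain_mono X (U i)) => k; exact: Ut.
have [T0 hT0] := accC (fun i => U i i) (fun i => CU i i)
  (fun i x h => Ut _ _ _ (Ui _ _ _ h)).
have [f hf] := choice (fun t => accC (U ^~ t) (CU ^~ t) (fun i => @Ui i t)).
exists (maxn T0 (\max_(t < T0) f t)) => i t x Dx Ux.
have [lt_t|le_t] := ltnP t T0.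
  apply: (leUi _ _ _ _ _ (hf _ _ _ Dx Ux)).
  exact: leq_trans (leq_bigmax (Ordinal lt_t)) (leq_maxr _ _).
apply: (leUi _ _ T0); first exact: leq_maxl.
apply: (leUt _ _ T0) => //; apply: (hT0 (maxn i t)) => //.
exact: (leUt _ _ _ _ (leq_maxr _ _) (leUi _ _ _ _ (leq_maxl _ _) Ux)).
Qed.

Lemma stationary_prop : @stationary_chains unit (fun=> True) (fun=> True).
Proof.
move=> U _ Umono; have [[T UT]|nU] := pselect (exists i, U i tt).
  by exists T => i [].
by exists 0%N => i [] _ Ui; case: nU; exists i.
Qed.

Lemma bitseq_count0 w : count id w = 0%N -> w = nseq (size w) false.
Proof. by elim: w => //= -[] //= w IH /IH {1}->. Qed.

Lemma bitseq_countS m w : count id w = m.+1 ->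
  exists t w', count id w' = m /\ w = nseq t false ++ true :: w'.
Proof.
elim: w => //= -[|] w IH /=; first by case=> ?; exists 0%N, w.
by move=> /IH[t [w' [? ->]]]; exists t.+1, w'.
Qed.

Lemma insertion_closed_prefix (U : bitseq -> Prop) u :
  insertion_closed U -> insertion_closed (fun w => U (u ++ w)).
Proof. by move=> Ucl v w; rewrite !catA; exact: Ucl. Qed.

(** Dickson's lemma, as an ascending chain condition. Words with m+1 ones are cut
after the first one; the set of tails increases with the number t of zeros in
front, so that the chain of sets becomes a family increasing in two indices. *)
Lemma stationary_insertion_closed m :
  stationary_chains (fun w => count id w = m) insertion_closed.
Proof.
elim: m => [|m IH] U Ucl Umono.
  have [||T hT] := stationary_double (U := fun i t (_ : unit) => U i (nseq t false))
    stationary_prop (fun _ _ => I).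
  - by move=> i t _; exact: Umono.
  - by move=> i t _; exact: (Ucl i [::]).
  exists T => i w /bitseq_count0 ->; exact: (hT i _ tt I).
have [|||T hT] :=
    stationary_double (U := fun i t w => U i (nseq t false ++ true :: w)) IH.
- move=> i t u v; have := Ucl i (nseq t false ++ true :: u) v.
  by rewrite -!catA.
- by move=> i t w; exact: Umono.
- by move=> i t w; exact: (Ucl i [::]).
by exists T => i w /bitseq_countS[t [w' [w'm ->]]]; exact: hT.
Qed.

(** The list is enumerated in lexicographic order, false before true. *)
Fixpoint words (m n : nat) : seq bitseq :=
  match n, m with
  | 0, 0 => [:: [::]]
  | 0, _.+1 => [::]
  | n'.+1, 0 => map (cons false) (words 0 n')
  | n'.+1, m'.+1 => map (cons false) (words m n') ++ map (cons true) (words m' n')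
  end.

Lemma mem_map_cons b (a : bool) w (s : seq bitseq) :
  (b :: w \in map (cons a) s) = (b == a) && (w \in s).
Proof.
apply/mapP/andP => [[v vs [-> ->]]|[/eqP-> ws]]; first by rewrite eqxx.
by exists w.
Qed.

Lemma mem_words m n w : (w \in words m n) = (size w == n) && (count id w == m).
Proof.
elim: n m w => [|n IH] [|m] [|b w] //=; try by apply/negP => /mapP[].
- by rewrite mem_map_cons IH eqSS; case: b; rewrite ?andbF.
- by apply/negbTE; rewrite mem_cat; apply/norP; split; apply/negP => /mapP[].
by rewrite mem_cat !mem_map_cons !IH !eqSS; case: b; rewrite ?orbF.
Qed.

Definition avoid_count (U : bitseq -> Prop) (m n : nat) : nat :=
  count (fun w => ~~ `[<U w>]) (words m n).

Lemma words0 n : words 0 n = [:: nseq n false].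
Proof. by elim: n => //= n ->. Qed.

Lemma avoid_count0_eventually_poly U :
  insertion_closed U -> eventually_poly (avoid_count U 0).
Proof.
move=> Ucl; have [[N UN]|nU] := pselect (exists n, U (nseq n false)).
  apply: (@eventually_poly_const 0%N N) => n leNn.
  rewrite /avoid_count words0 /= asboolT //.
  apply: (@chain_mono unit (fun i _ => U (nseq i false)) tt) leNn UN => i.
  exact: (Ucl [::]).
apply: (@eventually_poly_const 1%N 0%N) => n _.
rewrite /avoid_count words0 /= asboolF //.
by move=> Un; apply: nU; exists n.
Qed.

Lemma nseq_false_cat t (w : bitseq) :
  nseq t false ++ false :: w = nseq t.+1 false ++ w.
Proof. by elim: t => //= t ->. Qed.

Lemma avoid_countS U m n :
  avoid_count U m.+1 n.+1 =
    (avoid_count (fun w => U (true :: w)) m n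
      + avoid_count (fun w => U (false :: w)) m.+1 n)%N.
Proof. by rewrite /avoid_count /= count_cat !count_map addnC. Qed.

(** With V t the set of words that fall in U after t zeros are put in front, the
first letter gives: count of V t at n+1 = count of tails at n + count of V (t+1)
at n. For large t the last set agrees with V t, and the recursion becomes a
difference equation; smaller t follow by descending induction. *)
Lemma avoid_count_eventually_poly m U :
  insertion_closed U -> eventually_poly (avoid_count U m).
Proof.
elim: m U => [|m IH] U Ucl; first exact: avoid_count0_eventually_poly.
pose V t w := U (nseq t false ++ w).
have Vcl t : insertion_closed (V t) by exact: insertion_closed_prefix.
have Vrec t n : avoid_count (V t) m.+1 n.+1 =
    (avoid_count (fun w => V t (true :: w)) m n + avoid_count (V t.+1) m.+1 n)%N.
  rewrite avoid_countS; congr (_ + _)%N.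
  by apply: eq_count => w; rewrite /V nseq_false_cat.
have IHt t : eventually_poly (avoid_count (fun w => V t (true :: w)) m).
  by apply: IH; exact: (@insertion_closed_prefix (V t) [:: true] (Vcl t)).
have [||T hT] := @stationary_insertion_closed m (fun t w => V t (true :: w)).
- by move=> t; exact: (@insertion_closed_prefix (V t) [:: true] (Vcl t)).
- by move=> t w; exact: (Ucl [::]).
(* At the stationary stage, one more leading zero changes nothing. *)
have VT : eventually_poly (avoid_count (V T) m.+1).
  apply: eventually_poly_antidifference (IHt T) _ => n; rewrite Vrec; congr (_ + _)%N.
  apply: eq_in_count => w; rewrite mem_words => /andP[_ /eqP wm].
  congr (~~ _); apply: asbool_equiv_eq; split; last exact: (Ucl [::]).
  have [t [w' [w'm ->]]] := bitseq_countS wm.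
  rewrite /V !catA -!nseqD => /(hT (T.+1 + t)%N _ w'm).
  apply: (@chain_mono _ (fun t w => V t (true :: w))); last exact: leq_addr.
  by move=> i; exact: (Ucl [::]).
suff: forall k, eventually_poly (avoid_count (V (T - k)%N) m.+1).
  by move=> /(_ T); rewrite subnn.
elim=> [|k IHk]; first by rewrite subn0.
have [le_kT|lt_Tk] := leqP T k; first by rewrite (_ : T - k.+1 = T - k)%N //; lia.
apply: eventually_poly_shift 1%N _ _ _ (eventually_polyD (IHt (T - k.+1)%N) IHk) => n.
by rewrite addn1 Vrec subnSK.
Qed.

(** * Increasing maps as words *)

Lemma oi_mor_eq m n (f g : oi_mor m n) : (forall i, f i = g i) -> f = g.
Proof.
case: f g => [f hf] [g hg] /= fg; have {fg} fg : f = g by apply/ffunP.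
by rewrite fg in hf *; congr OIMor; exact: bool_irrelevance.
Qed.

Lemma oi_mor_lt m n (f : oi_mor m n) (i j : 'I_m) : (f i < f j)%N = (i < j)%N.
Proof.
have lt_f := oi_morP _ (oi_incr f).
case: (ltngtP i j) => [/lt_f ->//|/lt_f/ltnW|/val_inj->]; last by rewrite ltnn.
by rewrite leqNgt => /negbTE.
Qed.

Lemma oi_mor_inj m n (f : oi_mor m n) : injective f.
Proof.
move=> i j fij; apply/val_inj/eqP; rewrite eqn_leq (leqNgt i) (leqNgt j).
by rewrite -!(oi_mor_lt f) fij ltnn.
Qed.

Definition oi_mask m n (f : oi_mor m n) : bitseq :=
  [seq k \in codom f | k <- enum 'I_n].

Lemma size_oi_mask m n (f : oi_mor m n) : size (oi_mask f) = n.
Proof. by rewrite size_map size_enum_ord. Qed.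

Lemma nth_oi_mask m n (f : oi_mor m n) (k : 'I_n) :
  nth false (oi_mask f) k = (k \in codom f).
Proof. by rewrite (nth_map k) ?size_enum_ord // nth_ord_enum. Qed.

Lemma oi_mask_words m n (f : oi_mor m n) : oi_mask f \in words m n.
Proof.
rewrite mem_words size_oi_mask eqxx /= count_map.
have -> : count (preim [in codom f] id) (enum 'I_n) = #|codom f|.
  by rewrite cardE size_filter enumT.
by rewrite (card_codom (@oi_mor_inj m n f)) card_ord.
Qed.

Definition ord_lt n : rel 'I_n := fun i j => (i < j)%N.

Lemma ord_lt_trans n : transitive (@ord_lt n).
Proof. by move=> k i j; exact: ltn_trans. Qed.

Lemma enum_ord_sorted n : sorted (@ord_lt n) (enum 'I_n).
Proof.
have := iota_ltn_sorted 0 n; rewrite -val_enum_ord sorted_map.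
by apply: sub_sorted.
Qed.

Lemma oi_mask_surj m n w : w \in words m n -> exists f : oi_mor m n, oi_mask f = w.
Proof.
rewrite mem_words => /andP[/eqP wn /eqP wm].
pose s := mask w (enum 'I_n).
have sm : size s == m by rewrite size_mask ?size_enum_ord // wm.
have ss : sorted (@ord_lt n) s.
  exact: (sorted_mask (@ord_lt_trans n) w (enum_ord_sorted n)).
have incr : [forall i : 'I_m, forall j : 'I_m, (i < j)%N ==>
    ([ffun k => tnth (Tuple sm) k] i < [ffun k => tnth (Tuple sm) k] j)%N].
  apply/oi_morP => i j ij; set x0 := tnth (Tuple sm) i.
  have := sorted_ltn_nth (@ord_lt_trans n) x0 ss i j.
  by rewrite !inE (eqP sm) !ffunE !(tnth_nth x0) => /(_ (ltn_ord _) (ltn_ord _) ij).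
exists (OIMor incr); apply: (@eq_from_nth _ false); rewrite size_oi_mask // => k kn.
rewrite (nth_oi_mask (OIMor incr) (Ordinal kn)).
have -> : (Ordinal kn \in codom (OIMor incr)) = (Ordinal kn \in s).
  apply/codomP/idP => [[i ->]|/(tnthP (Tuple sm))[i ->]].
    by rewrite /= ffunE (mem_tnth i (Tuple sm)).
  by exists i; rewrite /= ffunE.
by rewrite in_mask ?enum_uniq // mem_enum /= index_enum_ord.
Qed.

Lemma oi_mask_inj m n : injective (@oi_mask m n).
Proof.
move=> f g fg; apply: oi_mor_eq.
have memE x : (x \in codom f) = (x \in codom g) by rewrite -!nth_oi_mask fg.
have ss (h : oi_mor m n) : sorted (@ord_lt n) (codom h).
  rewrite sorted_map.
  by apply: sub_sorted (enum_ord_sorted m) => i j; rewrite /= /ord_lt oi_mor_lt.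
have eq_codom : codom f = codom g.
  apply: (irr_sorted_eq (@ord_lt_trans n) _ (ss f) (ss g) memE) => x.
  exact: ltnn.
by move=> i; move/eq_in_map: eq_codom; apply; rewrite mem_enum.
Qed.

Lemma oi_skip_incr n (p : 'I_n.+1) :
  [forall i : 'I_n, forall j : 'I_n,
    (i < j)%N ==> ([ffun k => lift p k] i < [ffun k => lift p k] j)%N].
Proof. by apply/oi_morP => i j ij; rewrite !ffunE /= ltnNge leq_bump2 -ltnNge. Qed.

(** Every increasing map is a composite of maps skipping one value, so stability
under them is stability under all of OI. *)
Definition oi_skip n (p : 'I_n.+1) : oi_mor n n.+1 := OIMor (oi_skip_incr p).

Lemma oi_mask_skip m n (p : 'I_n.+1) (f : oi_mor m n) :
  oi_mask (oi_comp (oi_skip p) f) = take p (oi_mask f) ++ false :: drop p (oi_mask f).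
Proof.
have sz : size (take p (oi_mask f)) = p.
  by rewrite size_takel // size_oi_mask -ltnS.
apply: (@eq_from_nth _ false) => [|k].
  by rewrite size_cat /= addnS -size_cat cat_take_drop !size_oi_mask.
rewrite size_oi_mask => kn.
have {k kn}[x ->] : exists x : 'I_n.+1, k = x by exists (Ordinal kn).
rewrite nth_oi_mask nth_cat sz; case: (unliftP p x) => [j|] ->; last first.
  rewrite ltnn subnn; apply/codomP => -[i /eqP].
  by rewrite !ffunE (negbTE (neq_lift _ _)).
have -> : (lift p j \in codom (oi_comp (oi_skip p) f)) = (j \in codom f).
  apply/codomP/codomP => -[i]; rewrite ?ffunE => ij; exists i.
    exact: lift_inj ij.
  by rewrite !ffunE ij.
rewrite -nth_oi_mask /= /bump; case: (leqP p j) => [le_pj|lt_jp] /=.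
  by rewrite add1n ltnNge leqW //= subSn //= nth_drop subnKC.
by rewrite add0n lt_jp nth_take.
Qed.

Lemma oi_factor l m n (g : oi_mor m n) (f : oi_mor l n) :
  {subset codom f <= codom g} -> exists h : oi_mor l m, f = oi_comp g h.
Proof.
move=> sfg.
have [h hE] : exists h : {ffun 'I_l -> 'I_m}, forall i, g (h i) = f i.
  exists [ffun i => iinv (sfg _ (codom_f f i))] => i.
  by rewrite ffunE f_iinv.
have hincr : [forall i : 'I_l, forall j : 'I_l, (i < j)%N ==> (h i < h j)%N].
  by apply/oi_morP => i j ij; rewrite -(oi_mor_lt g) !hE oi_mor_lt.
by exists (OIMor hincr); apply: oi_mor_eq => i; rewrite /= ffunE hE.
Qed.

(** Any set of at most m positions can be enlarged to one with exactly m elements,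
which is the image of an increasing map. *)
Lemma oi_mor_through m n (A : {set 'I_n}) : (#|A| <= m <= n)%N ->
  exists f : oi_mor m n, {subset A <= codom f}.
Proof.
move=> /andP[Am mn]; pose s := enum A ++ enum (~: A).
have us : uniq s.
  rewrite cat_uniq !enum_uniq andbT; apply/hasPn => x /=.
  by rewrite !mem_enum inE.
have ss : size s = n by rewrite size_cat -!cardE cardsC card_ord.
have [|f fE] := @oi_mask_surj m n [seq k \in take m s | k <- enum 'I_n].
  rewrite mem_words size_map size_enum_ord eqxx count_map /=.
  have -> : count (preim [in take m s] id) (enum 'I_n) = #|take m s|.
    by rewrite cardE size_filter enumT.
  by rewrite (card_uniqP _) ?take_uniq // size_takel ?ss.
exists f => x xA; rewrite -nth_oi_mask fE (nth_map x) ?size_enum_ord //.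
rewrite nth_ord_enum take_cat ltnNge -cardE Am /= mem_cat.
by rewrite mem_enum xA.
Qed.

Fixpoint bitseq_lex (u v : bitseq) : bool :=
  match u, v with
  | a :: u', b :: v' => (~~ a && b) || (a == b) && bitseq_lex u' v'
  | _, _ => false
  end.

Lemma bitseq_lex_irr u : bitseq_lex u u = false.
Proof. by elim: u => //= -[]. Qed.

Lemma bitseq_lex_asym u v : bitseq_lex u v -> bitseq_lex v u = false.
Proof. by elim: u v => [|a u IH] [|b v] //=; case: a b => [] [] //= /IH. Qed.

(** Inserting the same letter at the same place leaves the first discrepancy of
two words in the same order. *)
Lemma bitseq_lex_insert u1 u2 v1 v2 b : size u1 = size v1 ->
  bitseq_lex (u1 ++ u2) (v1 ++ v2) -> bitseq_lex (u1 ++ b :: u2) (v1 ++ b :: v2).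
Proof.
elim: u1 v1 => [|a u1 IH] [|a' v1] //=; first by move=> _ ->; rewrite eqxx orbT.
by move=> [/IH{}IH] /orP[->//|/andP[-> /IH->]]; rewrite orbT.
Qed.

Lemma pairwise_words m n : pairwise bitseq_lex (words m n).
Proof.
have map_pw a s : pairwise bitseq_lex s -> pairwise bitseq_lex (map (cons a) s).
  by rewrite pairwise_map; apply: sub_pairwise => u v /= ->; rewrite eqxx orbT.
elim: n m => [|n IH] [|m] //=; first exact: map_pw.
rewrite pairwise_cat !map_pw // !andbT.
by apply/allrelP => u v /mapP[u' _ ->] /mapP[v' _ ->].
Qed.

(** * Spans, dimension and standard vectors *)

Section Span.
Variables (K : fieldType) (V : lmodType K).
Implicit Types (S : V -> Prop) (u v x : V).

Inductive lspan S : V -> Prop :=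
| lspan0 : lspan S 0
| lspanDZ k u v : S u -> lspan S v -> lspan S (k *: u + v).

Lemma lspan_gen S u : S u -> lspan S u.
Proof.
move=> Su; rewrite -[u]addr0 -[u]scale1r.
by apply: lspanDZ => //; exact: lspan0.
Qed.

Lemma lspanD S u v : lspan S u -> lspan S v -> lspan S (u + v).
Proof.
move=> + Sv; elim=> [|k w u' Sw _ IH]; first by rewrite add0r.
by rewrite -addrA; exact: lspanDZ.
Qed.

Lemma lspanZ S k u : lspan S u -> lspan S (k *: u).
Proof.
elim=> [|l w u' Sw _ IH]; first by rewrite scaler0; exact: lspan0.
by rewrite scalerDr scalerA; exact: lspanDZ.
Qed.

Lemma lspan_sum S (I : Type) (r : seq I) (h : I -> V) :
  (forall i, lspan S (h i)) -> lspan S (\sum_(i <- r) h i).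
Proof.
by move=> Sh; apply: big_ind => [|u v|//]; [exact: lspan0 | exact: lspanD].
Qed.

Lemma lspan_sub S S' v : (forall u, S u -> lspan S' u) -> lspan S v -> lspan S' v.
Proof.
move=> SS'; elim=> [|k u w Su _ IH]; first exact: lspan0.
by apply: lspanD => //; exact/lspanZ/SS'.
Qed.

Definition has_dim (W : V -> Prop) (d : nat) : Prop :=
  exists b : 'I_d -> V,
    [/\ forall i, W (b i),
        forall a : 'I_d -> K, \sum_(i < d) a i *: b i = 0 -> forall i, a i = 0
      & forall v, W v -> exists a : 'I_d -> K, v = \sum_(i < d) a i *: b i].

Lemma has_dim_eq (W W' : V -> Prop) d :
  (forall v, W v <-> W' v) -> has_dim W d -> has_dim W' d.
Proof.
by move=> WW' [b [Wb fb sb]]; exists b; split=> // [i|v /WW'/sb//]; exact/WW'.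
Qed.

Lemma has_dim0 S : (forall u, ~ S u) -> has_dim (lspan S) 0.
Proof.
move=> S0; exists (fun _ => 0); split=> [[]//|a _ []//|v Sv].
exists (fun=> 0); rewrite big_ord0.
by case: Sv => // k u w /S0.
Qed.

Lemma has_dimS S x d : ~ lspan S x -> has_dim (lspan S) d ->
  has_dim (lspan (fun v => S v \/ v = x)) d.+1.
Proof.
move=> nSx [b [Sb freeb spanb]].
pose ext T (h : 'I_d -> T) (y : T) i := if unlift ord_max i is Some k then h k else y.
have ext_lift T (h : 'I_d -> T) y k : ext T h y (lift ord_max k) = h k.
  by rewrite /ext liftK.
have ext_max T (h : 'I_d -> T) y : ext T h y ord_max = y by rewrite /ext unlift_none.
have sumE (a : 'I_d.+1 -> K) : \sum_i a i *: ext V b x i =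
    \sum_i a (lift ord_max i) *: b i + a ord_max *: x.
  rewrite (bigD1_ord ord_max) //= ext_max addrC; congr (_ + _).
  by apply: eq_bigr => i _; rewrite ext_lift.
have Sx_lspan v : lspan S v -> lspan (fun v => S v \/ v = x) v.
  by apply: lspan_sub => u Su; apply: lspan_gen; left.
exists (ext V b x); split=> [i|a|v].
- rewrite /ext; case: (unliftP ord_max i) => [k|] _; first exact: Sx_lspan.
  by apply: lspan_gen; right.
- rewrite sumE => /eqP; rewrite addr_eq0 => /eqP ab.
  (* Otherwise the relation would express x through S. *)
  have a0 : a ord_max = 0.
    apply: contra_notP nSx => /eqP an0.
    rewrite -[x]scale1r -(mulVf an0) -scalerA -[_ *: x]opprK -ab -scaleN1r.
    do 2![apply: lspanZ]; apply: lspan_sum => i; exact: lspanZ.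
  move: ab; rewrite a0 scale0r oppr0 => /freeb ab i.
  by case: (unliftP ord_max i) => [k|] ->.
elim=> [|k u w Su _ [a ->]].
  by exists (fun=> 0); rewrite big1 // => i _; rewrite scale0r.
have [a' ->] : exists a', u = \sum_i a' i *: ext V b x i.
  case: Su => [/lspan_gen/spanb[a' ->]|->].
    exists (ext K a' 0); rewrite sumE ext_max scale0r addr0.
    by apply: eq_bigr => i _; rewrite ext_lift.
  exists (ext K (fun=> 0) 1); rewrite sumE ext_max scale1r big1 ?add0r // => i _.
  by rewrite ext_lift scale0r.
exists (fun i => k * a' i + a i); rewrite scaler_sumr -big_split /=.
by apply: eq_bigr => i _; rewrite scalerA -scalerDl.
Qed.

(** Run through t in increasing order: a vector enlarges the span of its
predecessors, and then by one dimension, exactly when it is standard. *)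
Lemma has_dim_standard (I : eqType) (lt : rel I) (t : seq I) (f : I -> V) :
  (forall i j, lt i j -> lt j i = false) -> (forall i, lt i i = false) ->
  pairwise lt t ->
  has_dim (lspan (fun v => exists2 i, i \in t & v = f i))
    (count (fun i => ~~ `[< lspan (fun v =>
       exists k, [/\ k \in t, lt k i & v = f k]) (f i) >]) t).
Proof.
move=> lt_asym lt_irr; elim/last_ind: t => [_|t x IH].
  by apply: has_dim0 => u [].
rewrite pairwise_rcons => /andP[/allP lt_x /IH{}IH].
rewrite -cats1 count_cat /= addn0.
set d := count _ t in IH *.
have -> : count (fun i => ~~ `[< lspan (fun v =>
    exists k, [/\ k \in t ++ [:: x], lt k i & v = f k]) (f i) >]) t = d.
  apply: eq_in_count => i it; congr (~~ _); apply: asbool_equiv_eq.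
  split; apply: lspan_sub => u [k [kt ki ->]]; apply: lspan_gen; exists k.
    split=> //; move: kt ki; rewrite mem_cat inE => /orP[//|/eqP->].
    by rewrite lt_asym // lt_x.
  by rewrite mem_cat kt.
set S := fun v => exists2 i, i \in t & v = f i in IH.
set Sx := fun v => exists2 i, i \in t ++ [:: x] & v = f i.
have SxE v : (S v \/ v = f x) <-> Sx v.
  split=> [[[i it ->]|->]|[i]]; last first.
  - by rewrite mem_cat inE => /orP[it|/eqP->] ->; [left; exists i | right].
  - by exists x => //; rewrite mem_cat inE eqxx orbT.
  by exists i => //; rewrite mem_cat it.
have -> : lspan (fun v => exists k, [/\ k \in t ++ [:: x], lt k x & v = f k]) (f x)
    = lspan S (f x).
  apply/propext; split; apply: lspan_sub => u.
    move=> [k [kt kx ->]]; apply: lspan_gen; exists k => //.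
    move: kt; rewrite mem_cat inE => /orP[//|/eqP kE].
    by rewrite kE lt_irr in kx.
  move=> [k kt ->]; apply: lspan_gen; exists k.
  by rewrite mem_cat kt lt_x.
case: asboolP => [Sfx|nSfx]; rewrite ?addn0 ?addn1.
  apply: has_dim_eq IH => v; split; apply: lspan_sub => u.
    by move=> Su; apply/lspan_gen/SxE; left.
  by move=> /SxE[/lspan_gen//|->].
apply: has_dim_eq (has_dimS nSfx IH) => v.
by split; apply: lspan_sub => u /SxE; exact: lspan_gen.
Qed.

End Span.

Lemma lspan_linear (K : fieldType) (V W : lmodType K) (S : V -> Prop)
    (S' : W -> Prop) (g : V -> W) v :
  linear g -> (forall u, S u -> lspan S' (g u)) -> lspan S v -> lspan S' (g v).
Proof.
move=> glin gS; elim=> [|k u w Su _ IH].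
  have := glin (-1) 0 0; rewrite scaleN1r addNr => ->.
  by rewrite scaleN1r addNr; exact: lspan0.
by rewrite glin; apply: lspanD => //; exact/lspanZ/gS.
Qed.

(** * Dimension of the span of the images of finitely many vectors *)

HB.instance Definition _ m n := [isSub for @oi_fun m n].
HB.instance Definition _ m n := [Equality of oi_mor m n by <:].
HB.instance Definition _ m n := [Choice of oi_mor m n by <:].
HB.instance Definition _ m n := [Countable of oi_mor m n by <:].
HB.instance Definition _ m n := [Finite of oi_mor m n by <:].

Lemma oi_words m n : exists t : seq (oi_mor m n), map (@oi_mask m n) t = words m n.
Proof.
have: {subset words m n <= words m n} by [].
elim: {1 3}(words m n) => [|w s IH] sub; first by exists [::].
have [v vs|t tE] := IH; first by apply: sub; rewrite inE vs orbT.
have [|f fw] := @oi_mask_surj m n w; first by apply: sub; rewrite inE eqxx.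
by exists (f :: t); rewrite /= fw tE.
Qed.

Section OISpace.
Variables (K : fieldType) (V : nat -> lmodType K).
Variable F : forall m n, oi_mor m n -> V m -> V n.
Hypothesis F_linear : forall m n (f : oi_mor m n), linear (F f).
Hypothesis F_comp : forall l m n (g : oi_mor m n) (f : oi_mor l m) v,
  F (oi_comp g f) v = F g (F f v).

Variables (m : nat) (g : seq (V m)).

(** The pair (k, f) plays the role of a monomial of the free functor on the
elements of g. *)
Definition monomial n (p : nat * oi_mor m n) : V n := F p.2 (nth 0 g p.1).

Definition monomial_lt n (p q : nat * oi_mor m n) : bool :=
  (p.1 < q.1)%N || (p.1 == q.1) && bitseq_lex (oi_mask p.2) (oi_mask q.2).

Lemma monomial_lt_irr n (p : nat * oi_mor m n) : monomial_lt p p = false.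
Proof. by rewrite /monomial_lt ltnn bitseq_lex_irr andbF. Qed.

Lemma monomial_lt_asym n (p q : nat * oi_mor m n) :
  monomial_lt p q -> monomial_lt q p = false.
Proof.
rewrite /monomial_lt; case: ltngtP => //= _; exact: bitseq_lex_asym.
Qed.

Definition nonstandard n (p : nat * oi_mor m n) : Prop :=
  lspan (fun v => exists q,
    [/\ (q.1 < size g)%N, monomial_lt q p & v = monomial q]) (monomial p).

(** The width n and the map f are determined by the word w. *)
Definition nonstandard_word (k : nat) (w : bitseq) : Prop :=
  exists n (f : oi_mor m n), oi_mask f = w /\ nonstandard (k, f).

Lemma nonstandard_wordE n k (f : oi_mor m n) :
  nonstandard_word k (oi_mask f) <-> nonstandard (k, f).
Proof.
split=> [[n' [f' [fE]]]|]; last by exists n, f.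
have nE : n' = n by rewrite -(size_oi_mask f) -fE size_oi_mask.
by case: _ / nE f fE => f /oi_mask_inj->.
Qed.

Lemma monomial_lt_skip n (p : 'I_n.+1) (a b : nat * oi_mor m n) :
  monomial_lt a b ->
  monomial_lt (a.1, oi_comp (oi_skip p) a.2) (b.1, oi_comp (oi_skip p) b.2).
Proof.
move=> /orP[lt_ab|/andP[/eqP-> lt_ab]]; rewrite /monomial_lt /= ?lt_ab // eqxx /=.
rewrite !oi_mask_skip bitseq_lex_insert ?orbT ?cat_take_drop //.
by rewrite !size_takel // size_oi_mask -ltnS.
Qed.

(** Apply to a dependency of f_* g_k on smaller vectors the map induced by the
increasing map that skips one value: it preserves the order of the pairs, and
it inserts a zero in the words. *)
Lemma nonstandard_insertion_closed k : insertion_closed (nonstandard_word k).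
Proof.
move=> u v [n [f [fE nsf]]].
(* The zero is inserted after the prefix u. *)
have lt_un : (size u < n.+1)%N.
  by rewrite ltnS -(size_oi_mask f) fE size_cat leq_addr.
pose p := Ordinal lt_un; exists n.+1, (oi_comp (oi_skip p) f); split.
  by rewrite oi_mask_skip fE take_size_cat ?drop_size_cat.
rewrite /nonstandard /monomial /= F_comp; apply: lspan_linear nsf => // x.
move=> [q [q1 qlt ->]]; apply: lspan_gen.
exists (q.1, oi_comp (oi_skip p) q.2); split=> //; last by rewrite /monomial /= F_comp.
exact: (monomial_lt_skip p qlt).
Qed.

Lemma pairwise_monomial n s (t : seq (oi_mor m n)) :
  pairwise ltn s -> pairwise (relpre (@oi_mask m n) bitseq_lex) t ->
  pairwise (@monomial_lt n) [seq (k, f) | k <- s, f <- t].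
Proof.
elim: s => //= k s IH /andP[/allP lt_ks /IH{}IH] lt_t.
rewrite pairwise_cat IH // andbT pairwise_map; apply/andP; split; last first.
  apply: sub_pairwise lt_t => f f' /=.
  by rewrite /monomial_lt /= eqxx => ->; rewrite orbT.
apply/allrelP => _ _ /mapP[f _ ->] /allpairsP[[k' f'] [/lt_ks lt_kk' _ ->]].
by apply/orP; left.
Qed.

Theorem oi_span_dim_eventually_poly :
  exists h : nat -> nat, eventually_poly h /\ forall n,
  has_dim (lspan (fun v : V n => exists f : oi_mor m n, exists2 x, x \in g & v = F f x))
    (h n).
Proof.
exists (fun n => \sum_(k <- iota 0 (size g)) avoid_count (nonstandard_word k) m n)%N.
split.
  apply: eventually_poly_sum => k; apply: avoid_count_eventually_poly.
  exact: nonstandard_insertion_closed.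
move=> n; have [t tE] := oi_words m n.
have mem_t f : f \in t by rewrite -(mem_map (@oi_mask_inj m n)) tE oi_mask_words.
pose T := [seq (k, f) | k <- iota 0 (size g), f <- t].
have memT k f : ((k, f) \in T) = (k < size g)%N.
  apply/allpairsP/idP => [[[k' f'] /= [+ _ [-> _]]]|ltk].
    by rewrite mem_iota.
  by exists (k, f); rewrite mem_iota.
have pwT : pairwise (@monomial_lt n) T.
  apply: pairwise_monomial; last by rewrite -pairwise_map tE pairwise_words.
  by rewrite -sorted_pairwise ?iota_ltn_sorted //; exact: ltn_trans.
have := has_dim_standard (@monomial n) (@monomial_lt_asym n) (@monomial_lt_irr n) pwT.
set d := count _ T; have -> : d =
    (\sum_(k <- iota 0 (size g)) avoid_count (nonstandard_word k) m n)%N.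
  rewrite /d count_flatten sumnE !big_map; apply: eq_bigr => k _.
  rewrite /avoid_count -tE !count_map; apply: eq_count => f /=; congr (~~ _).
  apply: asbool_equiv_eq; rewrite nonstandard_wordE.
  split; apply: lspan_sub => u [[k' f'] [k'T klt ->]]; apply: lspan_gen.
    by exists (k', f'); rewrite -(memT k' f').
  by exists (k', f'); rewrite memT.
apply: has_dim_eq => v; split; apply: lspan_sub => u.
  move=> [[k f]]; rewrite memT => ltk ->; apply: lspan_gen.
  by exists f, (nth 0 g k) => //; exact: mem_nth.
move=> [f [x xg ->]]; apply: lspan_gen; exists (index x g, f).
  by rewrite memT index_mem.
by rewrite /monomial /= nth_index.
Qed.

End OISpace.

(** * Graded components of OI-modules *)

Section Restriction.
Variables (K : fieldType) (c n : nat) (V : lmodType (oiP K c n)).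

(** A copy of V carrying the K-vector space structure; V itself already has a
module structure, over the polynomial ring. *)
Definition restr : Type := V.
HB.instance Definition _ := GRing.Zmodule.on restr.

Lemma kscaleA a b (v : restr) : kscale a (kscale b v) = kscale (a * b) v.
Proof. by rewrite /kscale scalerA mpolyCM. Qed.
Lemma kscale1 : left_id 1 (@kscale K c n V).
Proof. by move=> v; rewrite /kscale mpolyC1 scale1r. Qed.
Lemma kscaleDr : right_distributive (@kscale K c n V) +%R.
Proof. by move=> a u v; rewrite /kscale scalerDr. Qed.
Lemma kscaleDl (v : restr) : {morph (fun a => kscale a v : restr) : a b / a + b}.
Proof. by move=> a b; rewrite /kscale mpolyCD scalerDl. Qed.

HB.instance Definition _ :=
  GRing.Zmodule_isLmodule.Build K restr kscaleA kscale1 kscaleDr kscaleDl.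

Lemma linear_oiP_scale (a : oiP K c n) : linear (fun v : restr => a *: (v : V) : restr).
Proof.
move=> k u v; rewrite scalerDr; congr (_ + _).
rewrite [LHS](scalerA a (k%:MP : oiP K c n)).
by rewrite mulrC -scalerA.
Qed.
End Restriction.

Section GradedComponent.
Variables (K : fieldType) (c : nat) (M : graded_oi_module K c).

Lemma linear_oi_map m n (f : oi_mor m n) :
  linear (oi_map M f : restr (M m) -> restr (M n)).
Proof.
move=> k u v; rewrite raddfD; congr (_ + _).
by rewrite [LHS]oi_map_semilinear /oiP_map comp_mpolyC.
Qed.

Definition var_prod n (l : seq ('I_c * 'I_n)) : oiP K c n :=
  \prod_(p <- l) oi_var K p.1 p.2.

Lemma oiP_map_var_prod m n (f : oi_mor m n) (l : seq ('I_c * 'I_m)) :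
  oiP_map f (var_prod l) = var_prod [seq (p.1, f p.2) | p <- l].
Proof.
rewrite /var_prod big_map /oiP_map rmorph_prod; apply: eq_bigr => p _.
exact: oiP_map_var.
Qed.

Lemma var_prod_homog n (l : seq ('I_c * 'I_n)) :
  (var_prod l : {mpoly K[c * n]}) \is (size l).-homog.
Proof.
elim: l => [|p l IH]; rewrite /var_prod ?big_nil ?big_cons; first exact: dhomog1.
rewrite /= -add1n; apply: dhomogM => //.
by rewrite dhomogX; apply/eqP; exact: mdeg1.
Qed.

Implicit Types G : seq {m : nat & (int * M m)%type}.

Definition generator_multiple G n (d : int) (v : restr (M n)) : Prop :=
  exists2 x, x \in G & exists (f : oi_mor (tag x) n) (l : seq ('I_c * 'I_n)),
    (size l)%:Z + (tagged x).1 = d /\ v = var_prod l *: oi_map M f (tagged x).2.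

Definition homogeneous_family G : Prop :=
  forall x, x \in G -> goi_comp M (tag x) (tagged x).1 (tagged x).2.

Lemma generator_multiple_oi_map G m n (f : oi_mor m n) d v :
  generator_multiple G d v -> generator_multiple G d (oi_map M f v : restr (M n)).
Proof.
move=> [x xG [h [l [ld ->]]]]; exists x => //.
exists (oi_comp f h), [seq (p.1, f p.2) | p <- l]; split; first by rewrite size_map.
by rewrite oi_map_semilinear oiP_map_var_prod oi_map_comp.
Qed.

(** Stability under the polynomial ring reduces to single variables, as monomials
are products of variables; a variable lengthens the product by one factor. *)
Lemma span_multiples_submodule G :
  is_oi_submodule (M := M)
    (fun n => lspan (fun v => exists d, generator_multiple G (n := n) d v)).
Proof.
pose N n := lspan (fun v => exists d, generator_multiple G (n := n) d v).
have Nmap m n (f : oi_mor m n) v : N m v -> N n (oi_map M f v).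
  apply: lspan_linear; first exact: linear_oi_map.
  move=> u [d ud]; apply: lspan_gen; exists d.
  exact: generator_multiple_oi_map.
have NX n (i : 'I_(c * n)) v : N n v -> N n (('X_i : oiP K c n) *: (v : M n)).
  apply: lspan_linear; first exact: linear_oiP_scale.
  move=> u [d [x xG [f [l [ld ->]]]]]; apply: lspan_gen.
  case/mxvec_indexP: i => i k; exists (1 + d); exists x => //.
  exists f, ((i, k) :: l); split; first by rewrite -ld addrA -intS.
  by rewrite scalerA /var_prod big_cons.
have NXm n (mm : 'X_{1.. c * n}) v : N n v -> N n (('X_[mm] : oiP K c n) *: (v : M n)).
  move=> Nv; rewrite mpolyXE_id; move: v Nv.
  apply: (big_ind (fun a : oiP K c n => forall v, N n v -> N n (a *: (v : M n)))).
  - by move=> v; rewrite scale1r.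
  - by move=> a b IHa IHb v Nv; rewrite -scalerA; exact/IHa/IHb.
  move=> i _; elim: (mm i) => [|e IH] v Nv; first by rewrite expr0 scale1r.
  by rewrite exprS -scalerA; exact/NX/IH.
split=> [n|n u v|n a v Nv|m n f v].
- exact: lspan0.
- exact: lspanD.
- elim/mpolyind: a => [|k mm a _ _ IH]; first by rewrite scale0r; exact: lspan0.
  rewrite scalerDl; apply: lspanD => //.
  by rewrite -mul_mpolyC -scalerA; apply: (lspanZ k); exact: NXm.
exact: Nmap.
Qed.

(** The homogeneous components of finitely many generators still generate. *)
Lemma exists_homogeneous_generators : oi_fin_gen M ->
  exists G, homogeneous_family G /\
    forall n v, lspan (fun v => exists d, generator_multiple G (n := n) d v) v.
Proof.
move=> [s sgen].
suff [G [Gh Gs]] : exists G, homogeneous_family G /\ forall x, x \in s ->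
    lspan (fun v => exists d, generator_multiple G (n := tag x) d v) (tagged x).
  exists G; split=> // n v; apply: contrapT => nv.
  by apply: (sgen _ (span_multiples_submodule G)) => //; exists n, v.
elim: s {sgen} => [|[n q] s [G [Gh Gs]]]; first by exists [::].
have [r [f [_ fW qE]]] := grading_span (goi_grading M n) q.
pose Gq := [seq Tagged (fun m => (int * M m)%type) (i, f i) | i <- r].
have catW G1 G2 m (v : restr (M m)) :
    (forall x, x \in G1 -> x \in G2) ->
    lspan (fun v => exists d, generator_multiple G1 d v) v ->
    lspan (fun v => exists d, generator_multiple G2 d v) v.
  move=> G12; apply: lspan_sub => u [d [x xG xu]]; apply: lspan_gen.
  by exists d; exists x => //; exact: G12.
exists (Gq ++ G); split=> [x|x].
  by rewrite mem_cat => /orP[/mapP[i _ ->]|/Gh//]; exact: fW.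
rewrite inE => /orP[/eqP->|/Gs]; last first.
  by apply: catW => y yG; rewrite mem_cat yG orbT.
apply: (catW Gq) => [y yG|]; first by rewrite mem_cat yG.
rewrite /= qE big_seq; apply: (big_ind (fun v : restr (M n) => lspan _ v)).
- exact: lspan0.
- by move=> u v; exact: lspanD.
move=> i ir; apply: lspan_gen; exists i.
exists (Tagged (fun m => (int * M m)%type) (i, f i)); first by apply/mapP; exists i.
exists (oi_id n), [::]; split; first by rewrite add0r.
by rewrite /var_prod big_nil scale1r oi_map_id.
Qed.

Lemma generator_multiple_homogeneous G n d (v : restr (M n)) :
  homogeneous_family G -> generator_multiple G d v -> goi_comp M n d v.
Proof.
move=> Gh [x /Gh xW [f [l [<- ->]]]]; apply: (grading_mul (goi_grading M n)).
  exact: var_prod_homog.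
exact: goi_map_comp.
Qed.

Lemma lspan_comp n d (S : restr (M n) -> Prop) v :
  (forall u, S u -> goi_comp M n d u) -> lspan S v -> goi_comp M n d v.
Proof.
have grad := goi_grading M n.
move=> SW; elim=> [|k u w /SW uW _ wW]; first exact: (grading0 grad).
by apply: (gradingD grad) => //; exact: (gradingZ grad).
Qed.

(** Collect a combination of multiples of generators by degree. Since the sum of
the graded pieces is direct, an element of degree d equals its degree d part. *)
Lemma component_span_multiples G n d v : homogeneous_family G ->
  (forall v, lspan (fun v => exists e, generator_multiple G (n := n) e v) v) ->
  goi_comp M n d v -> lspan (generator_multiple G (n := n) d) v.
Proof.
move=> Gh Gspan vW; have grad := goi_grading M n.
(* Requiring d among the degrees, with possibly zero part, avoids a case split. *)
have [r [f [ur dr fS vE]]] : exists (r : seq int) (f : int -> restr (M n)),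
    [/\ uniq r, d \in r, forall e, lspan (generator_multiple G (n := n) e) (f e)
      & (v : restr (M n)) = \sum_(e <- r) f e].
  elim: {v vW}(Gspan v) => [|k u w [e eu] _ [r [f [ur dr fS ->]]]].
    exists [:: d], (fun=> 0); split; rewrite ?mem_head ?big_seq1 // => e.
    exact: lspan0.
  have [r' [f' [ur' dr' er' fS' ->]]] : exists (r' : seq int) (f' : int -> restr (M n)),
    [/\ uniq r', d \in r', e \in r',
        forall e, lspan (generator_multiple G (n := n) e) (f' e)
      & \sum_(e <- r) f e = \sum_(e <- r') f' e].
    have [er|ner] := boolP (e \in r); first by exists r, f.
    exists (e :: r), (fun i => if i == e then 0 else f i); split.
    - by rewrite /= ner.
    - by rewrite inE dr orbT.
    - exact: mem_head.
    - by move=> i; case: eqP => // _; exact: lspan0.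
    rewrite big_cons eqxx add0r; apply: eq_big_seq => i ir.
    by case: eqP ir ner => // -> ->.
  exists r', (fun i => (if i == e then k *: u else 0) + f' i); split=> //.
    move=> i; apply: lspanD => //; case: eqP => [->|_]; last exact: lspan0.
    exact/lspanZ/lspan_gen.
  rewrite big_split -big_mkcond /=; congr (_ + _).
  by rewrite -big_filter (filter_pred1_uniq ur' er') big_seq1.
have fW e : goi_comp M n e (f e).
  by apply: lspan_comp (fS e) => u; exact: generator_multiple_homogeneous.
suff <- : f d = v by [].
apply/eqP; rewrite -subr_eq0; apply/eqP.
have := grading_direct grad (f := fun e => f e - (if e == d then v else 0)) ur _ _ dr.
rewrite eqxx; apply.
  move=> e; apply: (gradingD grad); first exact: fW.
  case: eqP => [->|_]; last by rewrite oppr0; exact: (grading0 grad).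
  by rewrite -scaleN1r -mpolyC1 -mpolyCN; exact: (gradingZ grad).
rewrite sumrB -vE -big_mkcond -big_filter (filter_pred1_uniq ur dr) big_seq1.
exact: subrr.
Qed.

(** The image of the map applied to the generator and the columns of the variables
occupy at most m positions, so one increasing map from [m] reaches them all. *)
Lemma generator_multiple_factor G d m n (v : restr (M n)) :
  (forall x, x \in G -> (tag x + `|d - (tagged x).1| <= m)%N) -> (m <= n)%N ->
  generator_multiple G d v ->
  exists (f : oi_mor m n), exists2 u, generator_multiple G d u & v = oi_map M f u.
Proof.
move=> Gm mn [x xG [h [l [ld ->]]]].
have ldE : size l = `|d - (tagged x).1|%N by rewrite -ld addrK.
(* The positions used by the map and by the variables. *)
pose A := [set k in codom h] :|: [set k in unzip2 l].
have Am : (#|A| <= m)%N.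
  apply: leq_trans (leq_card_setU _ _).1 _; apply: leq_trans (Gm x xG).
  rewrite !cardsE (card_codom (@oi_mor_inj _ _ h)) card_ord leq_add2l -ldE.
  by apply: leq_trans (card_size _) _; rewrite size_map.
have [|f Af] := @oi_mor_through m n A; first by rewrite Am.
have [|h' hE] := @oi_factor _ _ _ f h.
  by move=> k kh; apply: Af; rewrite !inE kh.
have [l' lE] : exists l', l = [seq (p.1, f p.2) | p <- l'].
  have: forall k, k \in unzip2 l -> k \in codom f.
    by move=> k kl; apply: Af; rewrite !inE kl orbT.
  elim: (l) => [|[i k] l1 IH] sub; first by exists [::].
  have [|l1' ->] := IH; first by move=> k' k'l; apply: sub; rewrite inE k'l orbT.
  have /codomP[k' ->] := sub k (mem_head _ _).
  by exists ((i, k') :: l1').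
exists f; exists (var_prod l' *: oi_map M h' (tagged x).2).
  by exists x => //; exists h', l'; split=> //; rewrite -ld lE size_map.
by rewrite oi_map_semilinear oiP_map_var_prod -lE -oi_map_comp -hE.
Qed.

Lemma finite_generator_multiples G n d :
  exists g : seq (restr (M n)), forall v, v \in g <-> generator_multiple G d v.
Proof.
elim: G => [|x G [g gE]]; first by exists [::] => v; split=> // -[].
pose gx : seq (restr (M n)) :=
  [seq var_prod (tval l) *: oi_map M f (tagged x).2
    | f <- enum {: oi_mor (tag x) n},
      l <- enum {: (`|d - (tagged x).1|).-tuple ('I_c * 'I_n)}].
exists ((if (`|d - (tagged x).1|)%N%:Z + (tagged x).1 == d then gx else [::])
  ++ g) => v.
rewrite mem_cat; split=> [/orP[|/gE[y yG yv]]|[y]].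
- case: eqP => // dE /allpairsP[[f l] /= [_ _ ->]]; exists x; first exact: mem_head.
  by exists f, l; rewrite size_tuple.
- by exists y => //; rewrite inE yG orbT.
rewrite inE => /orP[/eqP->|yG yv]; last by apply/orP; right; apply/gE; exists y.
move=> [f [l [ld ->]]]; apply/orP; left.
have ldE : size l == `|d - (tagged x).1|%N by rewrite -ld addrK.
rewrite -(eqP ldE) ld eqxx; apply/allpairsP; exists (f, Tuple ldE).
by rewrite !mem_enum.
Qed.

Lemma component_span G d : homogeneous_family G ->
  (forall n v, lspan (fun v => exists e, generator_multiple G (n := n) e v) v) ->
  exists m (g : seq (restr (M m))), forall n, (m <= n)%N -> forall v : restr (M n),
    lspan (fun v : restr (M n) => exists f : oi_mor m n,
        exists2 x, x \in g & v = oi_map M f x) v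
      <-> goi_comp M n d v.
Proof.
move=> Gh Gspan; pose m := \max_(x <- G) (tag x + `|d - (tagged x).1|)%N.
have [g gE] := finite_generator_multiples G m d; exists m, g => n mn v; split.
  apply: lspan_comp => _ [f [x /gE xd ->]]; apply: goi_map_comp.
  exact: generator_multiple_homogeneous xd.
move=> /(component_span_multiples Gh (Gspan n)); apply: lspan_sub => u ud.
apply: lspan_gen; have [|f [w /gE wg ->]] := generator_multiple_factor (m := m) _ mn ud.
  by move=> x xG; exact: leq_bigmax_seq.
by exists f, w.
Qed.

End GradedComponent.

Theorem theorem1p2 (K : fieldType) (c : nat) (hc : (1 <= c)%N)
    (M : graded_oi_module K c) (hM : oi_fin_gen M) (j : int) :
  exists p : {poly rat}, exists N : nat, forall n : nat, (N <= n)%N ->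
    exists d : nat, has_kdim (goi_comp M n j) d /\
      d%:R = p.[n%:R].
Proof.
have [G [Gh Gspan]] := exists_homogeneous_generators hM.
have [m [g gE]] := component_span j Gh Gspan.
have [h [[p [N hp]] hdim]] := oi_span_dim_eventually_poly
  (V := fun n => restr (M n)) (F := fun m n (f : oi_mor m n) => oi_map M f)
  (@linear_oi_map K c M) (@oi_map_comp K c M) g.
exists p, (maxn N m) => n; rewrite geq_max => /andP[leNn lemn].
exists (h n); split; last exact: hp.
(* has_kdim is has_dim for the scalars restricted to K. *)
exact: has_dim_eq (gE n lemn) (hdim n).
Qed.
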